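(* Let $d\ge 4$ be an even integer and suppose that $d=r+s$ for some integers $1\le s\le r$. Suppose that $\alpha\neq\beta$ in $\mathbb{T}$ satisfy Condition (P) (with respect to $r,s$). Let $V:=\alpha I_r\oplus\beta I_s\in\mathcal{U}(\mathbb{C}^d)$, $\mathcal{H}_1=\ker(V-\alpha I_d)$ and $\mathcal{H}_2=\ker(V-\beta I_d)$. The following statements are equivalent: (a) $V\in\mathrm{Sym}_3(\mathbb{C}^d)$, with a factorisation $V=J_1J_2J$ into symmetries, $J$ balanced, such that $\dim\mathcal{M}_1=1$ in the standard decomposition of $J$ relative to $\mathbb{C}^d=\mathcal{H}_1\oplus\mathcal{H}_2$. (b) $d$ is not divisible by $4$, $s=d/2=r$, $\alpha^{d/2}\beta^{d/2}=-1$, and with $d_0=d/2-1$, $|1-\alpha^{2j+1}\beta^{2j-1}|<|\alpha-\beta|$ for all $1\le j\le d_0$.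
   Context: $\mathbb{T}=\{z\in\mathbb{C}:|z|=1\}$; $\mathcal{U}(\mathbb{C}^d)$ is the group of unitary $d\times d$ matrices. A symmetry on $\mathbb{C}^d$ is an operator $J$ with $J=J^*=J^{-1}$; it is balanced if $\mathrm{tr}(J)\in\{0,1\}$. $\mathrm{Sym}_k(\mathbb{C}^d)$ is the set of all products of $k$ symmetries on $\mathbb{C}^d$. Condition (P): for $d=r+s$ with integers $1\le s\le r$, the numbers $\alpha\ne\beta\in\mathbb{T}$ satisfy Condition (P) if (i) $\alpha^r\beta^s\in\{-1,1\}$, and (ii) whenever $i,j\ge 0$ are integers, not both zero, with $\alpha^i\beta^j\in\{-1,1\}$, then $i+j\ge d$. (In particular $\alpha,\beta\notin\{-1,1\}$.) Standard decomposition: let $J$ be a symmetry on $\mathcal{H}_1\oplus\mathcal{H}_2$ with block form $\begin{bmatrix} A_1 & A_2 \\ A_2^* & A_4 \end{bmatrix}$. Put $\mathcal{M}_1=\mathrm{span}\{\ker(A_1-I),\ker(A_1+I)\}\subseteq\mathcal{H}_1$, $\mathcal{M}_2=\mathrm{span}\{\ker(A_4-I),\ker(A_4+I)\}\subseteq\mathcal{H}_2$, and $\mathcal{N}_k=\mathcal{H}_k\ominus\mathcal{M}_k$. Then $J$ is block diagonal with respect to $\mathcal{M}_1\oplus(\mathcal{N}_1\oplus\mathcal{N}_2)\oplus\mathcal{M}_2$; this is the standard decomposition of $J$ relative to $\mathcal{H}_1\oplus\mathcal{H}_2$. *)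

(* Defs.v *)
From HB Require Import structures.
From mathcomp Require Export all_boot all_order all_algebra.
From mathcomp Require Export spectral complex reals.

Set Implicit Arguments.
Unset Strict Implicit.
Unset Printing Implicit Defensive.

Import Order.TTheory GRing.Theory Num.Theory.

Local Open Scope ring_scope.
Local Open Scope sesquilinear_scope.

(* The field C of complex numbers is R[i] with R : realType; for z : R[i] the
   modulus `|z| is a (real, nonnegative) element of R[i].  C^d is the space
   'cV_d of column vectors, on which a matrix A acts by x |-> A *m x. *)

Definition pm1 (C : nzRingType) (z : C) : Prop := z = 1 \/ z = - 1.

Definition condition_P (C : nzRingType) (r s : nat) (alpha beta : C) : Prop :=
  pm1 (alpha ^+ r * beta ^+ s) /\
  (forall i j : nat, ~ (i = 0%N /\ j = 0%N) ->
     pm1 (alpha ^+ i * beta ^+ j) -> (r + s <= i + j)%N).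

(* [invmx J] is a junk value unless [J] is invertible, hence [unitmx]. *)
Definition is_symmetry (R : realType) (d : nat) (J : 'M[R[i]]_d) : Prop :=
  [/\ J = J ^t*, J \in unitmx & J = invmx J].

Definition balanced (R : realType) (d : nat) (J : 'M[R[i]]_d) : Prop :=
  \tr J = 0 \/ \tr J = 1.

Definition in_Sym (R : realType) (k d : nat) (A : 'M[R[i]]_d) : Prop :=
  exists Js : 'I_k -> 'M[R[i]]_d,
    (forall i, is_symmetry (Js i)) /\ A = \big[mulmx/1%:M]_(i < k) Js i.

Definition mxop (R : realType) (d : nat) (A : 'M[R[i]]_d) : 'End('cV[R[i]]_d) :=
  linfun (mulmx A).

Definition mxker (R : realType) (d : nat) (A : 'M[R[i]]_d) :
    {vspace 'cV[R[i]]_d} := lker (mxop A).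

(* For C^d = H (+) H', [daddv_pi H H'] is the projection onto H along H' (the
   orthogonal one when H' is the orthogonal complement of H), so on H the
   operator [corner H H' J] is the diagonal block of J at H. *)
Definition corner (R : realType) (d : nat) (H H' : {vspace 'cV[R[i]]_d})
    (J : 'M[R[i]]_d) : 'End('cV[R[i]]_d) :=
  (daddv_pi H H' \o mxop J)%VF.

(* The span of ker (A - I) and ker (A + I), both taken inside H.  Thus
   M_1 = stdM H_1 H_2 J and M_2 = stdM H_2 H_1 J. *)
Definition stdM (R : realType) (d : nat) (H H' : {vspace 'cV[R[i]]_d})
    (J : 'M[R[i]]_d) : {vspace 'cV[R[i]]_d} :=
  let A := corner H H' J in
  ((H :&: lker (A - \1%VF)%R) + (H :&: lker (A + \1%VF)%R))%VS.

(* Main.v *)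
(* Put W = V J, so that V = J1 J2 J means W = J1 J2; then J1 conjugates W into
   W^-1, and the spectrum of W is invariant under l |-> l^-1.  In block form
   J = [A B; B^* D], and W - alpha beta W^-1 is block diagonal with corners
   (alpha - beta) A and (beta - alpha) D.  Hence an eigenvalue l of W with
   l^2 <> alpha^2, beta^2 comes with the eigenvalue - alpha beta / l, and
   t = (l - alpha beta / l) / (alpha - beta) is an eigenvalue of A or of - D,
   so that |t| < 1: this is the strict inequality.
   If dim M_1 = 1 then r = s, dim M_2 = 1, and tr J is the sum of the signs of J
   on M_1 and M_2, so these signs are eps and - eps.  Starting from the
   eigenvalue eps alpha on M_1 and alternating the two moves above produces the
   eigenvalues eps (-1)^k alpha^(k+1) beta^k for k < r, since Condition (P)
   excludes l^2 = alpha^2, beta^2 before the last step.  If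
   alpha^r beta^r were - (-1)^r, the last step would yield the eigenvalue
   eps beta, which is incompatible with the signs on M_1 and M_2; so
   alpha^r beta^r = (-1)^r, and Condition (P) forces r to be odd.
   Conversely the inequalities allow one to choose A = - D and B real diagonal
   with these prescribed eigenvalues, and exchanging the unit eigenvectors of
   conjugate eigenvalues defines J1. *)

Require Import Defs.
From mathcomp Require Import all_boot all_order all_algebra.
From mathcomp Require Import spectral complex reals.
From mathcomp Require Import fingroup perm ring zify.

Import Order.TTheory GRing.Theory Num.Theory.

Local Open Scope ring_scope.

Set Implicit Arguments.
Unset Strict Implicit.

(** * Symmetries in block form *)

Lemma adjmxM (C : numClosedFieldType) (m n p : nat) (A : 'M[C]_(m, n))
    (B : 'M_(n, p)) :
  ((A *m B) ^t* = B ^t* *m A ^t*)%sesqui.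
Proof. by rewrite trmx_mul map_mxM. Qed.

Definition sqnorm (C : numClosedFieldType) (n : nat) (x : 'cV[C]_n) : C :=
  (x ^t* *m x)%sesqui 0 0.

Lemma sqnormE (C : numClosedFieldType) (n : nat) (x : 'cV[C]_n) :
  sqnorm x = \sum_i `|x i 0| ^+ 2.
Proof. by rewrite /sqnorm mxE; apply: eq_bigr => i _; rewrite !mxE normCKC. Qed.

Lemma sqnorm_ge0 (C : numClosedFieldType) (n : nat) (x : 'cV[C]_n) :
  0 <= sqnorm x.
Proof. by rewrite sqnormE sumr_ge0 // => i _; rewrite exprn_ge0. Qed.

Lemma sqnorm_eq0 (C : numClosedFieldType) (n : nat) (x : 'cV[C]_n) :
  (sqnorm x == 0) = (x == 0).
Proof.
rewrite sqnormE psumr_eq0 => [|i _]; last by rewrite exprn_ge0.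
apply/allP/eqP => [x0|-> i _ /=]; last by rewrite mxE normr0 expr0n.
apply/colP => i; rewrite mxE; apply/eqP.
by have := x0 i (mem_index_enum i); rewrite sqrf_eq0 normr_eq0.
Qed.

Lemma sqnormZ (C : numClosedFieldType) (n : nat) (c : C) (x : 'cV[C]_n) :
  sqnorm (c *: x) = `|c| ^+ 2 * sqnorm x.
Proof.
rewrite !sqnormE mulr_sumr; apply: eq_bigr => i _.
by rewrite mxE normrM exprMn.
Qed.

(** The squared norm of [B^* x] is [x^* B B^* x]. *)
Lemma mulmx_adj_eq0 (C : numClosedFieldType) (m n : nat) (B : 'M[C]_(m, n))
    (x : 'cV_m) :
  ((B *m (B ^t* *m x) = 0) -> (B ^t* *m x = 0))%sesqui.
Proof.
move=> h; apply/eqP; rewrite -sqnorm_eq0 /sqnorm adjmxM trmxCK -mulmxA h.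
by rewrite mulmx0 mxE.
Qed.

(** The entries of [J = J^*] and [J^2 = 1] for [J = [A B; B^* D]]; the remaining off-diagonal entry
    of [J^2 = 1] is the adjoint of the one listed. *)
Definition symmetry_blocks (C : numClosedFieldType) (m n : nat)
    (A : 'M[C]_m) (B : 'M[C]_(m, n)) (D : 'M[C]_n) : Prop :=
  ([/\ A ^t* = A, D ^t* = D, A *m A + B *m B ^t* = 1%:M,
       A *m B + B *m D = 0 & B ^t* *m B + D *m D = 1%:M])%sesqui.

Lemma symmetry_blocks_swap (C : numClosedFieldType) (m n : nat)
    (A : 'M[C]_m) (B : 'M[C]_(m, n)) (D : 'M[C]_n) :
  symmetry_blocks A B D -> symmetry_blocks D (B ^t*)%sesqui A.
Proof.
case=> hA hD h1 h2 h3; split=> //; rewrite ?trmxCK //; try by rewrite addrC.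
by rewrite -{1}hD -{1}hA -!adjmxM -map_mxD -raddfD /= addrC h2 trmx0 map_mx0.
Qed.

(** By [A^2 + B B^* = 1]. This is what identifies [M_1] with [ker B^*], the form in which it is used
    below. *)
Lemma corner_sq_ker (C : numClosedFieldType) (m n : nat)
    (A : 'M[C]_m) (B : 'M[C]_(m, n)) (D : 'M[C]_n) (x : 'cV_m) :
  symmetry_blocks A B D ->
  (B ^t* *m x = 0)%sesqui <-> A *m (A *m x) = x.
Proof.
case=> _ _ h _ _; have {}h : A *m (A *m x) + (B *m (B ^t* *m x))%sesqui = x.
  by rewrite !mulmxA -mulmxDl h mul1mx.
split=> h0; first by rewrite -[RHS]h h0 mulmx0 addr0.
by apply: mulmx_adj_eq0; apply: (@addrI _ (A *m (A *m x))); rewrite h h0 addr0.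
Qed.

Lemma corner_eigen_ker (C : numClosedFieldType) (m n : nat)
    (A : 'M[C]_m) (B : 'M[C]_(m, n)) (D : 'M[C]_n) (x : 'cV_m) (t : C) :
  symmetry_blocks A B D -> A *m x = t *: x -> x != 0 ->
  (B ^t* *m x = 0)%sesqui <-> t ^+ 2 = 1.
Proof.
move=> hJ hx x0; rewrite (corner_sq_ker _ hJ) hx -scalemxAr hx scalerA -expr2.
split=> [/eqP|->]; last by rewrite scale1r.
by rewrite -[X in _ == X]scale1r -subr_eq0 -scalerBl scaler_eq0 (negPf x0) orbF
           subr_eq0 => /eqP.
Qed.

(** From [|x|^2 = |A x|^2 + |B^* x|^2], where the last term is positive because [t^2 <> 1]. *)
Lemma corner_eigen_norm (C : numClosedFieldType) (m n : nat)
    (A : 'M[C]_m) (B : 'M[C]_(m, n)) (D : 'M[C]_n) (x : 'cV_m) (t : C) :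
  symmetry_blocks A B D -> A *m x = t *: x -> x != 0 ->
  t ^+ 2 != 1 -> `|t| < 1.
Proof.
move=> hJ hx x0 t1; rewrite -(@ltr_pXn2r _ 2) ?nnegrE ?normr_ge0 // expr1n.
have p0 : 0 < sqnorm x by rewrite lt_def sqnorm_eq0 x0 sqnorm_ge0.
have p1 : 0 < sqnorm (B ^t* *m x)%sesqui.
  rewrite lt_def sqnorm_ge0 andbT sqnorm_eq0; apply: contra t1 => /eqP h.
  by apply/eqP; apply/(corner_eigen_ker hJ hx x0).
rewrite -(ltr_pM2r p0) mul1r -sqnormZ -hx -subr_gt0.
suff <- : sqnorm (B ^t* *m x)%sesqui = sqnorm x - sqnorm (A *m x) by [].
case: hJ => hA _ h _ _.
have -> : sqnorm x = sqnorm (A *m x) + sqnorm (B ^t* *m x)%sesqui.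
  rewrite /sqnorm -{2}[x]mul1mx -h mulmxDl mulmxDr mxE.
  by rewrite !adjmxM trmxCK hA !mulmxA.
by rewrite addrC addKr.
Qed.

(** * Eigenvectors of V J *)

(** An eigenvector [x (+) y] of [V J], split into components so that the two summands can be
    exchanged. *)
Definition twisted_eigenpair (C : numClosedFieldType) (m n : nat)
    (A : 'M[C]_m) (B : 'M[C]_(m, n)) (D : 'M[C]_n) (alpha beta lam : C)
    (x : 'cV_m) (y : 'cV_n) : Prop :=
  [/\ (x != 0) || (y != 0), alpha *: (A *m x + B *m y) = lam *: x &
      (beta *: (B ^t* *m x + D *m y) = lam *: y)%sesqui].

(** The eigenvalue of [W - alpha beta W^-1] coming from [lam], rescaled to be one of [A] or of
    [- D]. *)
Definition corner_eigenvalue (C : numClosedFieldType) (alpha beta lam : C) : C :=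
  (lam - alpha * beta / lam) / (alpha - beta).

Lemma twisted_eigenpair_swap (C : numClosedFieldType) (m n : nat)
    (A : 'M[C]_m) (B : 'M[C]_(m, n)) (D : 'M[C]_n) (alpha beta lam : C)
    (x : 'cV_m) (y : 'cV_n) :
  twisted_eigenpair A B D alpha beta lam x y ->
  twisted_eigenpair D (B ^t*)%sesqui A beta alpha lam y x.
Proof.
case=> xy h1 h2; split; [by rewrite orbC | by rewrite addrC | ].
by rewrite trmxCK addrC.
Qed.

(* With [V = alpha I (+) beta I] and [W = V J], the operator
   [W - alpha beta W^-1] is block diagonal with corners [(alpha - beta) A] and
   [(beta - alpha) D]. *)
Lemma twisted_eigenpair_corner (C : numClosedFieldType) (m n : nat)
    (A : 'M[C]_m) (B : 'M[C]_(m, n)) (D : 'M[C]_n) (alpha beta lam : C)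
    (x : 'cV_m) (y : 'cV_n) :
  symmetry_blocks A B D -> alpha != 0 -> beta != 0 -> lam != 0 ->
  alpha != beta -> twisted_eigenpair A B D alpha beta lam x y ->
  A *m x = corner_eigenvalue alpha beta lam *: x.
Proof.
case=> _ _ hA hAB _ a0 b0 l0 ab [_ h1 h2].
have {}h1 : A *m x + B *m y = (lam / alpha) *: x.
  by rewrite mulrC -scalerA -h1 scalerA mulVf ?scale1r.
have {}h2 : (B ^t* *m x + D *m y = (lam / beta) *: y)%sesqui.
  by rewrite mulrC -scalerA -h2 scalerA mulVf ?scale1r.
have E : (lam / alpha) *: (A *m x) + (lam / beta) *: (B *m y) = x.
  rewrite 2!scalemxAr -h1 -h2 !mulmxDr !mulmxA addrACA -!mulmxDl hA hAB.
  by rewrite mul1mx mul0mx addr0.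
move: E; have -> : B *m y = (lam / alpha) *: x - A *m x by rewrite -h1 addrC addKr.
move=> /colP E; apply/colP => i; move: (E i); rewrite !mxE /corner_eigenvalue.
set u := (\sum_ _ _); set v := x i 0 => e.
have d0 : alpha - beta != 0 by rewrite subr_eq0.
apply: (mulfI d0); apply: (mulfI l0).
have -> : lam * ((alpha - beta) * ((lam - alpha * beta / lam) / (alpha - beta) * v))
   = lam ^+ 2 * v - alpha * beta * v by field; rewrite l0 d0.
rewrite -{2}e; by field; rewrite a0 b0.
Qed.

(** Exchanging the summands carries the formula for [A] to the one for [D]; the eigenvector
    equations then give [B y] and [B^* x]. *)
Lemma twisted_eigenpair_ker (C : numClosedFieldType) (m n : nat)
    (A : 'M[C]_m) (B : 'M[C]_(m, n)) (D : 'M[C]_n) (alpha beta lam : C)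
    (x : 'cV_m) (y : 'cV_n) :
  symmetry_blocks A B D -> alpha != 0 -> beta != 0 -> lam != 0 ->
  alpha != beta -> twisted_eigenpair A B D alpha beta lam x y ->
  let t := corner_eigenvalue alpha beta lam in
  [/\ A *m x = t *: x, D *m y = - t *: y,
      B *m y = (lam / alpha - t) *: x &
      (B ^t* *m x = (lam / beta + t) *: y)%sesqui].
Proof.
move=> hJ a0 b0 l0 ab hv t.
have hx := twisted_eigenpair_corner hJ a0 b0 l0 ab hv.
have hy : D *m y = - t *: y.
  rewrite (twisted_eigenpair_corner (symmetry_blocks_swap hJ) b0 a0 l0 _
    (twisted_eigenpair_swap hv)) 1?eq_sym //; congr (_ *: _).
  rewrite /t /corner_eigenvalue; field.
  by rewrite -subr_eq0 in ab; rewrite l0 ab -oppr_eq0 opprB ab.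
case: hv => _ h1 h2; split=> //.
  rewrite scalerBl -hx mulrC -scalerA -h1 scalerA mulVf // scale1r.
  by rewrite addrC addKr.
rewrite -[t]opprK scalerBl -hy mulrC -scalerA -h2 scalerA mulVf // scale1r.
by rewrite addrK.
Qed.

(** With [t] the corner eigenvalue, [lam^2 (alpha - beta)^2 (t^2 - 1)] factors as
    [(lam^2 - alpha^2) (lam^2 - beta^2)]. *)
Lemma corner_eigenvalue_sq_eq1 (C : numClosedFieldType) (alpha beta lam : C) :
  lam != 0 -> alpha != beta -> corner_eigenvalue alpha beta lam ^+ 2 = 1 ->
  lam ^+ 2 = alpha ^+ 2 \/ lam ^+ 2 = beta ^+ 2.
Proof.
move=> l0 ab h; have d0 : alpha - beta != 0 by rewrite subr_eq0.
have /eqP : (lam ^+ 2 - alpha ^+ 2) * (lam ^+ 2 - beta ^+ 2) = 0.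
  transitivity (lam ^+ 2 * (alpha - beta) ^+ 2
                * (corner_eigenvalue alpha beta lam ^+ 2 - 1)).
    by rewrite /corner_eigenvalue; field; rewrite l0 d0.
  by rewrite h subrr mulr0.
by rewrite mulf_eq0 !subr_eq0 => /orP[]/eqP; [left|right].
Qed.

Lemma twisted_eigenpair_norm (C : numClosedFieldType) (m n : nat)
    (A : 'M[C]_m) (B : 'M[C]_(m, n)) (D : 'M[C]_n) (alpha beta lam : C)
    (x : 'cV_m) (y : 'cV_n) :
  symmetry_blocks A B D -> alpha != 0 -> beta != 0 -> lam != 0 ->
  alpha != beta -> twisted_eigenpair A B D alpha beta lam x y ->
  lam ^+ 2 != alpha ^+ 2 -> lam ^+ 2 != beta ^+ 2 ->
  `|corner_eigenvalue alpha beta lam| < 1.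
Proof.
move=> hJ a0 b0 l0 ab hv la lb.
have t1 : corner_eigenvalue alpha beta lam ^+ 2 != 1.
  apply/eqP => /(corner_eigenvalue_sq_eq1 l0 ab) []; first exact/eqP.
  exact/eqP.
have [hx hy _ _] := twisted_eigenpair_ker hJ a0 b0 l0 ab hv.
case: hv => /orP[x0|y0] _ _; first exact: corner_eigen_norm hJ hx x0 t1.
rewrite -normrN; apply: (corner_eigen_norm (symmetry_blocks_swap hJ) hy y0).
by rewrite sqrrN.
Qed.

(* [p x (+) q y] lies in the plane spanned by [x] and [y], on which [W] has
   determinant [- alpha * beta]. *)
Lemma twisted_eigenpair_partner (C : numClosedFieldType) (m n : nat)
    (A : 'M[C]_m) (B : 'M[C]_(m, n)) (D : 'M[C]_n) (alpha beta lam : C)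
    (x : 'cV_m) (y : 'cV_n) :
  symmetry_blocks A B D -> alpha != 0 -> beta != 0 -> lam != 0 ->
  alpha != beta -> twisted_eigenpair A B D alpha beta lam x y ->
  lam ^+ 2 != alpha ^+ 2 -> lam ^+ 2 != beta ^+ 2 ->
  let t := corner_eigenvalue alpha beta lam in
  let mu := - (alpha * beta / lam) in
  twisted_eigenpair A B D alpha beta mu
    ((lam - alpha * t) *: x) ((mu - alpha * t) *: y).
Proof.
move=> hJ a0 b0 l0 ab hv la lb t mu.
have [hx hy hBy hBx] := twisted_eigenpair_ker hJ a0 b0 l0 ab hv.
rewrite -/t in hx hy hBy hBx.
have d0 : alpha - beta != 0 by rewrite subr_eq0.
have tE : t * (alpha - beta) = lam + mu by rewrite /t /corner_eigenvalue divfK.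
have hJ' := symmetry_blocks_swap hJ.
(* If [x = 0], then [B y = 0] with [y] nonzero, so [t^2 = 1]; the formula for [B^* x] gives
   [lam = - beta t], against [lam^2 <> beta^2]. *)
have x0 : x != 0.
  apply: contra lb => /eqP x0; have y0 : y != 0.
    by case: hv; rewrite x0 eqxx.
  have By0 : B *m y = 0 by rewrite hBy x0 scaler0.
  have /eqP := hBx; rewrite x0 mulmx0 eq_sym scaler_eq0 (negPf y0) orbF => /eqP tl.
  have := corner_eigen_ker hJ' hy y0; rewrite trmxCK sqrrN => -[/(_ By0) t2 _].
  have -> : lam = - beta * t.
    rewrite mulNr -[RHS]addr0 -(mulr0 beta) -tl; field; exact: b0.
  by rewrite exprMn t2 sqrrN mulr1.
(* If [lam = alpha t], then [B y = 0]. Whether [y] vanishes or not, [t^2 = 1] follows, against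
   [lam^2 <> alpha^2]. *)
have p0 : lam - alpha * t != 0.
  apply: contra la; rewrite subr_eq0 => /eqP le.
  have lE : lam / alpha = t by rewrite le mulrC mulKf.
  have By0 : B *m y = 0 by rewrite hBy lE subrr scale0r.
  have [y0|y0] := eqVneq y 0.
    have Bx0 : (B ^t* *m x = 0)%sesqui by rewrite hBx y0 scaler0.
    by have [/(_ Bx0) t2 _] := corner_eigen_ker hJ hx x0; rewrite le exprMn t2 mulr1.
  have := corner_eigen_ker hJ' hy y0; rewrite trmxCK sqrrN => -[/(_ By0) t2 _].
  by rewrite le exprMn t2 mulr1.
split; first by rewrite scaler_eq0 negb_or p0 x0.
  rewrite -!scalemxAr hx hBy !scalerA -scalerDl !scalerA; congr (_ *: _).
  have -> : mu = t * (alpha - beta) - lam by rewrite tE addrC addKr.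
  by field.
rewrite -!scalemxAr hy hBx !scalerA -scalerDl !scalerA; congr (_ *: _).
have -> : mu = t * (alpha - beta) - lam by rewrite tE addrC addKr.
by field.
Qed.

(** * The kernels of B and of its adjoint *)

(** Rank-nullity; [kermx] is a kernel on row vectors, hence the transposes. *)
Lemma kernel_line_rank (F : fieldType) (m n : nat) (K : 'M[F]_(n, m)) :
  (exists2 e : 'cV_m, e != 0 /\ K *m e = 0 &
     forall x : 'cV_m, K *m x = 0 -> exists c, x = c *: e) <->
  (\rank K).+1 = m.
Proof.
split=> [[e [e0 Ke] h]|rK].
  have eT0 : e^T != 0 by rewrite -(inj_eq trmx_inj) trmx0 trmxK.
  have le1 : (kermx K^T <= e^T)%MS.
    apply/row_subP => i; have [|c /(congr1 trmx)] := h (row i (kermx K^T))^T.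
      by apply: trmx_inj; rewrite trmx_mul trmxK trmx0 -row_mul mulmx_ker row0.
    by rewrite trmxK linearZ /= => ->; rewrite scalemx_sub.
  have le2 : (e^T <= kermx K^T)%MS.
    by apply/sub_kermxP; rewrite -trmx_mul Ke trmx0.
  have := eqmx_rank (introT andP (conj le1 le2)).
  rewrite mxrank_ker mxrank_tr rank_rV eT0 /= => r1.
  by have := rank_leq_col K; lia.
have r1 : \rank (kermx K^T) = 1%N by rewrite mxrank_ker mxrank_tr -{1}rK subSnn.
have k0 : kermx K^T != 0 by rewrite -mxrank_eq0 r1.
have nz : nz_row (kermx K^T) != 0 by rewrite nz_row_eq0.
have le2 := nz_row_sub (kermx K^T).
exists (nz_row (kermx K^T))^T.
  split; first by rewrite -(inj_eq trmx_inj) trmx0 trmxK.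
  by apply: trmx_inj; rewrite trmx_mul trmxK trmx0; apply/sub_kermxP.
move=> x Kx.
have kx : (x^T <= kermx K^T)%MS by apply/sub_kermxP; rewrite -trmx_mul Kx trmx0.
have le1 : (kermx K^T <= nz_row (kermx K^T))%MS.
  by rewrite -(mxrank_leqif_sup le2) r1 rank_rV nz.
have := submx_trans kx le1.
by case/sub_rVP => c /(congr1 trmx); rewrite trmxK linearZ /=; exists c.
Qed.

(** Since [B^* A = - D B^*], the line [ker B^*] is invariant under [A], and [A^2 = 1] on it. *)
Lemma corner_kernel_line (C : numClosedFieldType) (m n : nat)
    (A : 'M[C]_m) (B : 'M[C]_(m, n)) (D : 'M[C]_n) (e : 'cV_m) :
  symmetry_blocks A B D -> e != 0 -> (B ^t* *m e = 0)%sesqui ->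
  (forall x : 'cV_m, (B ^t* *m x = 0)%sesqui -> exists c, x = c *: e) ->
  exists2 eps : C, eps ^+ 2 = 1 & A *m e = eps *: e.
Proof.
move=> hJ e0 Be h.
have [_ _ _ /= hCA _] := symmetry_blocks_swap hJ.
have [|eps he] := h (A *m e).
  move: hCA => /(congr1 (mulmx^~ e)) /=.
  by rewrite mulmxDl -!mulmxA Be mulmx0 add0r mul0mx.
by exists eps => //; apply/(corner_eigen_ker hJ he e0).
Qed.

(* [B + e f^*] is invertible and intertwines [A] with [- D] up to the rank one
   term [(a + b) e f^*]. *)
Lemma corner_trace (C : numClosedFieldType) (n : nat)
    (A B D : 'M[C]_n) (e f : 'cV_n) (a b : C) :
  symmetry_blocks A B D -> e != 0 -> f != 0 ->
  (B ^t* *m e = 0)%sesqui -> B *m f = 0 ->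
  (forall x : 'cV_n, B *m x = 0 -> exists c, x = c *: f) ->
  A *m e = a *: e -> D *m f = b *: f -> b ^* = b ->
  \tr A + \tr D = a + b.
Proof.
move=> [hA hD _ hAB _] e0 f0 Be Bf h Ae Df bR.
pose fs : 'rV_n := (f ^t*)%sesqui.
have fsf : fs *m f = (sqnorm f)%:M by rewrite [LHS]mx11_scalar.
have f1 : sqnorm f != 0 by rewrite sqnorm_eq0.
pose B' := B + e *m fs.
have fD : fs *m D = b *: fs.
  by rewrite -hD -adjmxM Df; apply/rowP => i; rewrite !mxE rmorphM /= bR.
have B'f : B' *m f = sqnorm f *: e.
  by rewrite mulmxDl Bf add0r -mulmxA fsf mul_mx_scalar.
(* If [B' z = 0], then [B z] is a multiple of [e], so [B^* B z = 0] and [B z = 0]. Hence [z = c f],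
   and [B' f = |f|^2 e] forces [c = 0]. *)
have uB : B' \in unitmx.
  rewrite -unitmx_tr -row_free_unit -kermx_eq0; apply/eqP/row_matrixP => i.
  rewrite row0; apply: trmx_inj; rewrite trmx0.
  set z := (row i _)^T.
  have B'z : B' *m z = 0.
    by apply: trmx_inj; rewrite trmx_mul trmxK -row_mul mulmx_ker row0 trmx0.
  have Bz : B *m z = 0.
    rewrite -[B]trmxCK; apply: mulmx_adj_eq0; rewrite trmxCK.
    have -> : B *m z = - (e *m (fs *m z)).
      by apply/eqP; rewrite -addr_eq0 mulmxA -mulmxDl B'z.
    by rewrite mulmxN [_ *m (e *m _)]mulmxA Be mul0mx oppr0.
  have [c zE] := h z Bz.
  move: B'z; rewrite zE -scalemxAr B'f scalerA => /eqP.
  by rewrite scaler_eq0 (negPf e0) orbF mulf_eq0 (negPf f1) orbF => /eqP->; rewrite scale0r.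
have E : A *m B' + B' *m D = (a + b) *: (e *m fs).
  rewrite mulmxDr mulmxDl addrACA hAB add0r mulmxA Ae -mulmxA fD.
  by rewrite -scalemxAl -scalemxAr scalerDl.
have {}E : A + B' *m D *m invmx B' = (a + b) *: (e *m fs *m invmx B').
  by rewrite scalemxAl -E mulmxDl mulmxK.
have fE : invmx B' *m e = (sqnorm f)^-1 *: f.
  by rewrite -[e]scale1r -(mulVf f1) -scalerA -B'f -scalemxAr mulKmx.
(* Conjugation by [B'] preserves the trace of [D], and [e f^* B'^-1] has trace [f^* B'^-1 e = 1]. *)
move/(congr1 mxtrace): E.
rewrite mxtraceD mxtraceZ -mulmxA mxtrace_mulC mulmxKV // -[e *m fs *m _]mulmxA.
rewrite mxtrace_mulC -mulmxA fE -scalemxAr fsf mxtraceZ mxtrace_scalar mulVf //.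
by rewrite mulr1.
Qed.

(** * The chain of eigenvalues *)

(** Squaring treats the two values [1] and [- 1] of Condition (P) at once. *)
Lemma condition_P_sq (C : numClosedFieldType) (r s : nat) (alpha beta : C)
    (i j : nat) :
  condition_P r s alpha beta -> (0 < i + j < r + s)%N ->
  (alpha ^+ i * beta ^+ j) ^+ 2 != 1.
Proof.
move=> [_ hP] /andP[ij0 ijd]; rewrite sqrf_eq1; apply/negP => h.
have : (r + s <= i + j)%N.
  by apply: hP; [lia | case/orP: h => /eqP; [left|right]].
by rewrite leqNgt ijd.
Qed.

Lemma twisted_eigenpair_block (C : numClosedFieldType) (m n : nat)
    (A : 'M[C]_m) (B : 'M[C]_(m, n)) (D : 'M[C]_n) (alpha beta lam : C)
    (x : 'cV_m) (y : 'cV_n) :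
  twisted_eigenpair A B D alpha beta lam x y <->
  (col_mx x y != 0 /\
   block_mx alpha%:M 0 0 beta%:M *m (block_mx A B (B ^t*)%sesqui D *m col_mx x y)
   = lam *: col_mx x y).
Proof.
rewrite !mul_block_col !mul0mx addr0 add0r !mul_scalar_mx scale_col_mx.
rewrite col_mx_eq0 negb_and.
by split=> [[-> -> ->]|[? /eq_col_mx []]].
Qed.

(** For [W = J1 J2], [J1 W J1 = J2 J1 = W^-1]; the new eigenvector is the image under [J1]. *)
Lemma twisted_eigenpair_inv (C : numClosedFieldType) (m n : nat)
    (A : 'M[C]_m) (B : 'M[C]_(m, n)) (D : 'M[C]_n) (J1 J2 : 'M[C]_(m + n))
    (alpha beta lam : C) (x : 'cV_m) (y : 'cV_n) :
  J1 *m J1 = 1%:M -> J2 *m J2 = 1%:M ->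
  block_mx alpha%:M 0 0 beta%:M *m block_mx A B (B ^t*)%sesqui D = J1 *m J2 ->
  lam != 0 -> twisted_eigenpair A B D alpha beta lam x y ->
  exists x' y', twisted_eigenpair A B D alpha beta lam^-1 x' y'.
Proof.
move=> hJ1 hJ2 hW l0 /twisted_eigenpair_block [v0]; rewrite mulmxA hW => hv.
pose v := J1 *m col_mx x y.
have J1v : J1 *m v = col_mx x y by rewrite mulmxA hJ1 mul1mx.
exists (usubmx v), (dsubmx v); apply/twisted_eigenpair_block.
rewrite mulmxA hW vsubmxK; split.
  by apply: contra v0 => /eqP h; rewrite -J1v h mulmx0.
rewrite -mulmxA -[J2 *m v]scale1r -(mulVf l0) -scalerA scalemxAr.
have -> : lam *: v = J2 *m col_mx x y.
  rewrite scalemxAr -hv !mulmxA hJ1 mul1mx.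
  by [].
by rewrite mulmxA hJ2 mul1mx scalemxAr.
Qed.

Definition chain_eigenvalue (C : nzRingType) (alpha beta eps : C) (k : nat) : C :=
  eps * (-1) ^+ k * alpha ^+ k.+1 * beta ^+ k.

Lemma chain_eigenvalue_sq (C : numClosedFieldType) (alpha beta eps : C)
    (k : nat) :
  eps ^+ 2 = 1 ->
  chain_eigenvalue alpha beta eps k ^+ 2 = (alpha ^+ k.+1 * beta ^+ k) ^+ 2.
Proof. by move=> e1; rewrite /chain_eigenvalue -mulrA exprMn exprMn e1 sqrr_sign !mul1r. Qed.

(** An equality would make the square of [alpha^(k+2) beta^k] or of [alpha^(k+1) beta^(k+1)] equal
    to 1, with exponent sum [2k + 2 < 2r]. *)
Lemma chain_eigenvalue_inv_sq (C : numClosedFieldType) (r : nat)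
    (alpha beta eps : C) (k : nat) :
  condition_P r r alpha beta -> eps ^+ 2 = 1 -> alpha != 0 -> beta != 0 ->
  (k.+1 < r)%N ->
  (chain_eigenvalue alpha beta eps k)^-1 ^+ 2 != alpha ^+ 2 /\
  (chain_eigenvalue alpha beta eps k)^-1 ^+ 2 != beta ^+ 2.
Proof.
move=> hP e1 a0 b0 kr; rewrite exprVn chain_eigenvalue_sq //.
have P0 : (alpha ^+ k.+1 * beta ^+ k) ^+ 2 != 0.
  by rewrite expf_neq0 // mulf_neq0 // expf_neq0.
have E z : ((alpha ^+ k.+1 * beta ^+ k) ^+ 2)^-1 = z ^+ 2 ->
    (z * (alpha ^+ k.+1 * beta ^+ k)) ^+ 2 = 1.
  by move=> h; rewrite [LHS]exprMn -h mulVf.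
split; apply/eqP => /E; rewrite ?mulrA ?[beta * _]mulrC.
  by rewrite -exprS; apply/eqP/(condition_P_sq hP); lia.
by rewrite -mulrA -exprS; apply/eqP/(condition_P_sq hP); lia.
Qed.

(** Inverses appear because the partner of the inverse of the [k]-th value is the value of index
    [k + 1], which is then inverted. *)
Lemma eigen_chain (C : numClosedFieldType) (r : nat)
    (A B D : 'M[C]_r) (J1 J2 : 'M[C]_(r + r)) (alpha beta eps : C) (e : 'cV_r) :
  symmetry_blocks A B D -> J1 *m J1 = 1%:M -> J2 *m J2 = 1%:M ->
  block_mx alpha%:M 0 0 beta%:M *m block_mx A B (B ^t*)%sesqui D = J1 *m J2 ->
  condition_P r r alpha beta -> alpha != 0 -> beta != 0 -> alpha != beta ->
  e != 0 -> eps ^+ 2 = 1 -> A *m e = eps *: e ->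
  forall k, (k < r)%N -> exists x y,
    twisted_eigenpair A B D alpha beta (chain_eigenvalue alpha beta eps k)^-1 x y.
Proof.
move=> hJ hJ1 hJ2 hW hP a0 b0 ab e0 eps1 he.
have eps0 : eps != 0 by rewrite -sqrf_eq0 eps1 oner_eq0.
have l0 k : chain_eigenvalue alpha beta eps k != 0.
  by rewrite !mulf_neq0 ?expf_neq0 // oppr_eq0 oner_eq0.
elim=> [|k IH] kr.
  apply: (@twisted_eigenpair_inv _ _ _ _ _ _ _ _ _ _ _ e 0) hJ1 hJ2 hW (l0 _) _.
  have [_ /(_ eps1) Be] := corner_eigen_ker hJ he e0.
  split; rewrite ?e0 // mulmx0 addr0 ?Be ?scaler0 //.
  by rewrite he scalerA /chain_eigenvalue expr0 expr1 !mulr1 mulrC.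
have [x [y hv]] := IH (ltnW kr).
have [la lb] := chain_eigenvalue_inv_sq hP eps1 a0 b0 kr.
have li0 : (chain_eigenvalue alpha beta eps k)^-1 != 0 by rewrite invr_eq0.
have := twisted_eigenpair_partner hJ a0 b0 li0 ab hv la lb.
set mu := - _; have -> : mu = chain_eigenvalue alpha beta eps k.+1.
  by rewrite /mu /chain_eigenvalue invrK !exprS; ring.
exact: twisted_eigenpair_inv hJ1 hJ2 hW (l0 _).
Qed.

Lemma chain_strict (C : numClosedFieldType) (r : nat)
    (A B D : 'M[C]_r) (J1 J2 : 'M[C]_(r + r)) (alpha beta eps : C) (e : 'cV_r) :
  symmetry_blocks A B D -> J1 *m J1 = 1%:M -> J2 *m J2 = 1%:M ->
  block_mx alpha%:M 0 0 beta%:M *m block_mx A B (B ^t*)%sesqui D = J1 *m J2 ->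
  condition_P r r alpha beta -> `|alpha| = 1 -> `|beta| = 1 -> alpha != beta ->
  e != 0 -> eps ^+ 2 = 1 -> A *m e = eps *: e ->
  forall k, (k.+1 < r)%N ->
    `|1 - alpha ^+ (2 * k + 3) * beta ^+ (2 * k + 1)| < `|alpha - beta|.
Proof.
move=> hJ hJ1 hJ2 hW hP a1 b1 ab e0 eps1 he k kr.
have a0 : alpha != 0 by rewrite -normr_eq0 a1 oner_eq0.
have b0 : beta != 0 by rewrite -normr_eq0 b1 oner_eq0.
have eps0 : eps != 0 by rewrite -sqrf_eq0 eps1 oner_eq0.
have [x [y hv]] := eigen_chain hJ hJ1 hJ2 hW hP a0 b0 ab e0 eps1 he (ltnW kr).
have [la lb] := chain_eigenvalue_inv_sq hP eps1 a0 b0 kr.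
have l0 : chain_eigenvalue alpha beta eps k != 0.
  by rewrite !mulf_neq0 ?expf_neq0 // oppr_eq0 oner_eq0.
have li0 : (chain_eigenvalue alpha beta eps k)^-1 != 0 by rewrite invr_eq0.
have := twisted_eigenpair_norm hJ a0 b0 li0 ab hv la lb.
have d0 : 0 < `|alpha - beta| by rewrite normr_gt0 subr_eq0.
rewrite /corner_eigenvalue normf_div ltr_pdivrMr // mul1r.
congr (_ < _).
(* Multiplying by the chain eigenvalue, of modulus 1, turns the numerator of the corner eigenvalue
   into the required difference. *)
have -> : 1 - alpha ^+ (2 * k + 3) * beta ^+ (2 * k + 1) =
   chain_eigenvalue alpha beta eps k *
   ((chain_eigenvalue alpha beta eps k)^-1
    - alpha * beta / (chain_eigenvalue alpha beta eps k)^-1).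
  rewrite mulrBr mulfV // invrK mulrCA -expr2 chain_eigenvalue_sq //.
  by congr (1 - _); rewrite mul2n -addnn !exprD !exprS; ring.
rewrite normrM.
suff -> : `|chain_eigenvalue alpha beta eps k| = 1 by rewrite mul1r.
have eps_n : `|eps| = 1.
  by apply/eqP; rewrite -sqrp_eq1 ?normr_ge0 // -normrX eps1 normr1.
by rewrite !normrM !normrX a1 b1 eps_n normrN1 !expr1n !mulr1.
Qed.

Lemma chain_sign (C : numClosedFieldType) (r : nat)
    (A B D : 'M[C]_r) (J1 J2 : 'M[C]_(r + r)) (alpha beta eps : C)
    (e f : 'cV_r) :
  symmetry_blocks A B D -> J1 *m J1 = 1%:M -> J2 *m J2 = 1%:M ->
  block_mx alpha%:M 0 0 beta%:M *m block_mx A B (B ^t*)%sesqui D = J1 *m J2 ->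
  condition_P r r alpha beta -> `|alpha| = 1 -> `|beta| = 1 -> alpha != beta ->
  (0 < r)%N ->
  e != 0 -> eps ^+ 2 = 1 -> A *m e = eps *: e -> D *m f = - eps *: f ->
  (forall x : 'cV_r, (B ^t* *m x = 0)%sesqui -> exists c, x = c *: e) ->
  (forall x : 'cV_r, B *m x = 0 -> exists c, x = c *: f) ->
  alpha ^+ r * beta ^+ r = (-1) ^+ r.
Proof.
move=> hJ hJ1 hJ2 hW hP a1 b1 ab r0 e0 eps1 he hf kerE kerF.
have a0 : alpha != 0 by rewrite -normr_eq0 a1 oner_eq0.
have b0 : beta != 0 by rewrite -normr_eq0 b1 oner_eq0.
have eps0 : eps != 0 by rewrite -sqrf_eq0 eps1 oner_eq0.
have [m rE] : exists m, r = m.+1 by exists r.-1; rewrite prednK.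
have [x [y]] : exists x y,
    twisted_eigenpair A B D alpha beta (chain_eigenvalue alpha beta eps m)^-1 x y.
  by apply: (eigen_chain hJ hJ1 hJ2 hW hP a0 b0 ab e0 eps1 he); rewrite rE.
have : (alpha ^+ r * beta ^+ r) ^+ 2 == (-1) ^+ r ^+ 2.
  by rewrite sqrr_sign; case: hP => -[] -> _; rewrite ?sqrrN expr1n.
rewrite eqf_sqr => /orP[/eqP //|/eqP dE].
(* Under the opposite sign, the chain ends at [eps beta], whose corner eigenvalue is [- eps]. *)
have -> : (chain_eigenvalue alpha beta eps m)^-1 = eps * beta.
  apply: invr_inj; rewrite invrK.
  apply: (mulIf (mulf_neq0 eps0 b0)); rewrite mulVf ?mulf_neq0 //.
  transitivity (eps ^+ 2 * (-1) ^+ m * (alpha ^+ r * beta ^+ r)).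
    by rewrite rE /chain_eigenvalue !exprS; ring.
  by rewrite eps1 dE rE exprS mulN1r opprK mul1r -expr2 sqrr_sign.
move=> hv; have eb0 : eps * beta != 0 by rewrite mulf_neq0.
have [hx hy _ _] := twisted_eigenpair_ker hJ a0 b0 eb0 ab hv.
have tE : corner_eigenvalue alpha beta (eps * beta) = - eps.
  have d0 : alpha - beta != 0 by rewrite subr_eq0.
  have epsV : eps^-1 = eps by apply: (mulfI eps0); rewrite mulfV // -expr2 eps1.
  rewrite /corner_eigenvalue invfM epsV; apply: (mulIf d0); rewrite divfK //.
  by field.
have t1 : (- eps) ^+ 2 = 1 by rewrite sqrrN.
have n2 (z : 'cV[C]_r) : eps *: z = - eps *: z -> z = 0.
  move/eqP; rewrite -subr_eq0 -scalerBl opprK -mulr2n scaler_eq0 mulrn_eq0 /=.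
  by rewrite (negPf eps0) => /eqP.
(* A nonzero [x] would lie on the line of [e], where [A] acts as [eps], yet [A x = - eps x];
   likewise for [y], [f] and [D]. *)
have x0 : x = 0.
  apply/eqP; apply/negPn/negP => xn; rewrite tE in hx.
  have [_ /(_ t1) /kerE [c xE]] := corner_eigen_ker hJ hx xn.
  move/eqP: xn; apply; apply: n2; rewrite -hx xE -scalemxAr he !scalerA.
  by congr (_ *: _); rewrite mulrC.
have y0 : y = 0.
  apply/eqP; apply/negPn/negP => yn; rewrite tE opprK in hy.
  have := corner_eigen_ker (symmetry_blocks_swap hJ) hy yn; rewrite trmxCK.
  case=> _ /(_ eps1) /kerF [c yE].
  move/eqP: yn; apply; apply: n2; rewrite -hy yE -scalemxAr hf !scalerA.
  by congr (_ *: _); rewrite mulrC.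
by case: hv; rewrite x0 y0 eqxx.
Qed.

(** For even [r], the square of [alpha^(r/2) beta^(r/2)] would be 1, with exponent sum [r < 2r]. *)
Lemma condition_P_sign_odd (C : numClosedFieldType) (r : nat) (alpha beta : C) :
  (0 < r)%N -> condition_P r r alpha beta ->
  alpha ^+ r * beta ^+ r = (-1) ^+ r -> odd r.
Proof.
move=> r0 hP h; apply/negPn/negP => ev.
have rE : r = (r./2 * 2)%N by rewrite muln2 even_halfK.
have := @condition_P_sq _ _ _ _ _ r./2 r./2 hP; rewrite exprMn -!exprM -rE h.
rewrite -signr_odd (negPf ev) expr0 eqxx => h'.
suff /h' : (0 < r./2 + r./2 < r + r)%N by [].
by lia.
Qed.

(** * The space M_1 of the standard decomposition *)

Lemma mem_mxker (R : realType) (d : nat) (M : 'M[R[i]]_d) (v : 'cV_d) :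
  (v \in mxker M) = (M *m v == 0).
Proof. by rewrite memv_ker lfunE. Qed.

Lemma mem_mxker_block1 (R : realType) (m n : nat) (alpha beta : R[i])
    (v : 'cV_(m + n)) :
  alpha != beta ->
  (v \in mxker (block_mx (alpha%:M : 'M_m) 0 0 (beta%:M : 'M_n) - alpha%:M))
  = (dsubmx v == 0).
Proof.
move=> ab; rewrite mem_mxker mulmxBl -{1 2}[v]vsubmxK mul_block_col !mul0mx addr0 add0r.
rewrite !mul_scalar_mx scale_col_mx opp_col_mx add_col_mx subrr -scalerBl.
by rewrite col_mx_eq0 eqxx scaler_eq0 subr_eq0 eq_sym (negPf ab).
Qed.

Lemma mem_mxker_block2 (R : realType) (m n : nat) (alpha beta : R[i])
    (v : 'cV_(m + n)) :
  alpha != beta ->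
  (v \in mxker (block_mx (alpha%:M : 'M_m) 0 0 (beta%:M : 'M_n) - beta%:M))
  = (usubmx v == 0).
Proof.
move=> ab; rewrite mem_mxker mulmxBl -{1 2}[v]vsubmxK mul_block_col !mul0mx addr0 add0r.
rewrite !mul_scalar_mx scale_col_mx opp_col_mx add_col_mx subrr -scalerBl.
by rewrite col_mx_eq0 eqxx andbT scaler_eq0 subr_eq0 (negPf ab).
Qed.

Lemma daddv_pi_block (R : realType) (m n : nat) (alpha beta : R[i])
    (v : 'cV_(m + n)) :
  alpha != beta ->
  let V := block_mx (alpha%:M : 'M_m) 0 0 (beta%:M : 'M_n) in
  daddv_pi (mxker (V - alpha%:M)) (mxker (V - beta%:M)) v
  = col_mx (usubmx v) 0.
Proof.
move=> ab V.
set H1 := mxker _; set H2 := mxker _.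
have mH1 w : (w \in H1) = (dsubmx w == 0) by exact: mem_mxker_block1.
have mH2 w : (w \in H2) = (usubmx w == 0) by exact: mem_mxker_block2.
clearbody H1 H2.
have cap0 : (H1 :&: H2 = 0)%VS.
  apply/eqP; rewrite -subv0; apply/subvP => w.
  rewrite memv_cap mH1 mH2.
  case/andP=> /eqP d0 /eqP u0.
  by rewrite -[w]vsubmxK d0 u0 col_mx0 mem0v.
have m1 (x : 'cV_m) : col_mx x 0 \in H1 by rewrite mH1 col_mxKd.
have m2 (y : 'cV_n) : col_mx 0 y \in H2 by rewrite mH2 col_mxKu.
have p2 (y : 'cV_n) : daddv_pi H1 H2 (col_mx 0 y) = 0.
  have cap0' : (H2 :&: H1 = 0)%VS by rewrite capvC.
  have := daddv_pi_add cap0 (subvP (addvSr _ _) _ (m2 y)).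
  by rewrite (daddv_pi_id cap0' (m2 y)) => /eqP; rewrite -subr_eq0 addrK => /eqP.
have -> : v = col_mx (usubmx v) 0 + col_mx 0 (dsubmx v).
  by rewrite add_col_mx addr0 add0r vsubmxK.
by rewrite linearD /= p2 addr0 daddv_pi_id // !(col_mxKu, add_col_mx) addr0.
Qed.

(** Eigenvectors of [A] for [1] and [- 1] satisfy [A^2 u = u]; conversely such a [u] is the sum of
    the halves of [u + A u] and [u - A u]. *)
Lemma mem_stdM (R : realType) (m n : nat) (alpha beta : R[i])
    (A : 'M[R[i]]_m) (B : 'M[R[i]]_(m, n)) (D : 'M[R[i]]_n)
    (v : 'cV_(m + n)) :
  alpha != beta -> symmetry_blocks A B D ->
  let V := block_mx (alpha%:M : 'M_m) 0 0 (beta%:M : 'M_n) in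
  v \in stdM (mxker (V - alpha%:M)) (mxker (V - beta%:M))
    (block_mx A B (B ^t*)%sesqui D)
  <-> dsubmx v = 0 /\ (B ^t* *m usubmx v)%sesqui = 0.
Proof.
move=> ab hJ V; set H1 := mxker _; set H2 := mxker _; set J := block_mx A _ _ _.
have mH1 w : (w \in H1) = (dsubmx w == 0) by exact: mem_mxker_block1.
have cE (x : 'cV_m) : corner H1 H2 J (col_mx x 0) = col_mx (A *m x) 0.
  by rewrite comp_lfunE lfunE /= daddv_pi_block // mul_block_col !mulmx0 addr0 col_mxKu.
clearbody H1 H2.
have kP (c : R[i]) w : c ^+ 2 = 1 -> w \in H1 -> corner H1 H2 J w = c *: w ->
    dsubmx w = 0 /\ (B ^t* *m usubmx w)%sesqui = 0.
  rewrite mH1 => c2 /eqP w0.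
  rewrite -[w]vsubmxK w0 cE scale_col_mx => /eq_col_mx [hw _].
  rewrite col_mxKd col_mxKu; split=> //; apply/(corner_sq_ker _ hJ).
  by rewrite hw -scalemxAr hw scalerA -expr2 c2 scale1r.
split.
  case/memv_addP => w1 hw1 [w2 hw2 ->].
  move: hw1; rewrite memv_cap memv_ker => /andP[h1].
  rewrite add_lfunE opp_lfunE id_lfunE subr_eq0 => /eqP e1.
  move: hw2; rewrite memv_cap memv_ker => /andP[h2].
  rewrite add_lfunE id_lfunE addr_eq0 => /eqP e2.
  have [d1 b1] := kP 1 w1 (expr1n _ _) h1 (etrans e1 (esym (scale1r _))).
  have [] := kP (-1) w2 _ h2; rewrite ?sqrrN ?expr1n ?scaleN1r // => d2 b2.
  by rewrite !linearD /= d1 d2 b1 b2 !addr0.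
case=> d0 /(corner_sq_ker _ hJ).
rewrite -[v]vsubmxK d0 col_mxKu; set u := usubmx v => Au.
have uE : u = 2^-1 *: (u + A *m u) + 2^-1 *: (u - A *m u).
  by rewrite -scalerDr addrACA subrr addr0 -mulr2n -[u *+ 2]scaler_nat scalerA
    mulVf ?scale1r ?pnatr_eq0.
have -> : col_mx u 0 = col_mx (2^-1 *: (u + A *m u)) 0 +
    col_mx (2^-1 *: (u - A *m u)) (0 : 'cV_n).
  by rewrite add_col_mx addr0 -uE.
apply: memv_add; rewrite memv_cap mH1 col_mxKd eqxx memv_ker.
  rewrite add_lfunE opp_lfunE id_lfunE subr_eq0 cE -scalemxAr mulmxDr Au.
  by rewrite [u + _]addrC eqxx.
rewrite add_lfunE id_lfunE addr_eq0 cE -scalemxAr mulmxBr Au.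
by rewrite opp_col_mx oppr0 -scalerN opprB eqxx.
Qed.

Lemma dim_stdM_eq1 (R : realType) (m n : nat) (alpha beta : R[i])
    (A : 'M[R[i]]_m) (B : 'M[R[i]]_(m, n)) (D : 'M[R[i]]_n) :
  alpha != beta -> symmetry_blocks A B D ->
  let V := block_mx (alpha%:M : 'M_m) 0 0 (beta%:M : 'M_n) in
  \dim (stdM (mxker (V - alpha%:M)) (mxker (V - beta%:M))
    (block_mx A B (B ^t*)%sesqui D)) = 1%N <->
  exists2 e : 'cV_m, e != 0 /\ (B ^t* *m e)%sesqui = 0 &
     forall x : 'cV_m, (B ^t* *m x)%sesqui = 0 -> exists c, x = c *: e.
Proof.
move=> ab hJ V; set M := stdM _ _ _.
have mM v : v \in M <-> dsubmx v = 0 /\ (B ^t* *m usubmx v)%sesqui = 0.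
  exact: mem_stdM.
clearbody M; split=> [d1|[e [e0 Be] h]].
  have nz : vpick M != 0 by rewrite vpick0 -dimv_eq0 d1.
  have pM := memv_pick M; have [pd pB] := (mM _).1 pM.
  have ME : M = <[vpick M]>%VS.
    by apply/eqP; rewrite eq_sym eqEdim -memvE pM d1 dim_vline nz.
  exists (usubmx (vpick M)).
    split=> //; apply: contra nz => /eqP u0.
    by rewrite -[vpick M]vsubmxK u0 pd col_mx0.
  move=> x Bx; have : col_mx x 0 \in M by apply/mM; rewrite col_mxKd col_mxKu.
  rewrite {1}ME => /vlineP[c cE]; exists c.
  by rewrite -[x](col_mxKu x (0 : 'cV_n)) cE linearZ.
have -> : M = <[col_mx e (0 : 'cV_n)]>%VS.
  apply/vspaceP => v; apply/idP/vlineP.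
    case/mM => vd /h [c vu]; exists c.
    by rewrite -[v]vsubmxK vd vu scale_col_mx scaler0.
  case=> c ->; apply/mM; rewrite scale_col_mx col_mxKd col_mxKu scaler0.
  by rewrite -scalemxAr Be scaler0.
by rewrite dim_vline col_mx_eq0 (negPf e0).
Qed.

(** * Factorisation of a reflection with paired spectrum *)

Lemma unit_conj (C : numClosedFieldType) (z : C) : `|z| = 1 -> z^* = z^-1.
Proof.
move=> z1; have z0 : z != 0 by rewrite -normr_eq0 z1 oner_eq0.
by apply: (mulfI z0); rewrite mulfV // -normCK z1 expr1n.
Qed.

(** The hypotheses say that [diag(alpha, beta) [a b; b -a]] has trace [lam + mu] and determinant
    [lam mu], so [lam] is an eigenvalue. *)
Lemma reflection_unit_eigenvector (C : numClosedFieldType)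
    (alpha beta lam mu a b : C) :
  alpha != 0 -> a * (alpha - beta) = lam + mu ->
  lam * mu = - (alpha * beta) -> a ^+ 2 + b ^+ 2 = 1 ->
  exists p q : C, [/\ p * p^* + q * q^* = 1, alpha * (a * p + b * q) = lam * p &
    beta * (b * p - a * q) = lam * q].
Proof.
move=> a0 ha hl hb.
suff [p0 [q0 [pq0 h1 h2]]] : exists p q : C, [/\ (p != 0) || (q != 0),
    alpha * (a * p + b * q) = lam * p & beta * (b * p - a * q) = lam * q].
  pose n := sqrtC (`|p0| ^+ 2 + `|q0| ^+ 2).
  have n2 : n ^+ 2 = `|p0| ^+ 2 + `|q0| ^+ 2 by rewrite sqrtCK.
  have nz : n != 0.
    rewrite -sqrf_eq0 n2 paddr_eq0 ?exprn_ge0 // !sqrf_eq0 !normr_eq0.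
    by rewrite negb_and.
  have nn z : n^-1 * z * (n^-1 * z)^* = (n ^+ 2)^-1 * `|z| ^+ 2.
    have ng : 0 <= n^-1 by rewrite invr_ge0 sqrtC_ge0 addr_ge0 ?exprn_ge0.
    by rewrite -normCK normrM exprMn ger0_norm // exprVn.
  exists (n^-1 * p0), (n^-1 * q0); split.
  - by rewrite !nn -mulrDr -n2 mulVf // sqrf_eq0.
  - have -> : alpha * (a * (n^-1 * p0) + b * (n^-1 * q0))
      = n^-1 * (alpha * (a * p0 + b * q0)) by ring.
    by rewrite h1; ring.
  - have -> : beta * (b * (n^-1 * p0) - a * (n^-1 * q0))
      = n^-1 * (beta * (b * p0 - a * q0)) by ring.
    by rewrite h2; ring.
have mE : mu = a * (alpha - beta) - lam by rewrite ha addrC addKr.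
rewrite mE in hl.
(* For [b = 0] the matrix is diagonal with entries [alpha a] and [- beta a]. Otherwise the first row
   determines the vector, and the second row is the characteristic equation. *)
have [b0|b0] := eqVneq b 0.
  have [la|la] := eqVneq lam (alpha * a).
    exists 1, 0; rewrite oner_eq0 b0 la; split=> //; ring.
  have lb : lam = - (beta * a).
    apply/eqP; rewrite -addr_eq0; move: la; rewrite -subr_eq0 => la.
    rewrite -(inj_eq (mulfI la)) mulr0; apply/eqP.
    transitivity (- (lam * (a * (alpha - beta) - lam)) - alpha * beta * a ^+ 2); first by ring.
    by rewrite hl opprK -[X in X - _]mulr1 -mulrBr -hb b0; ring.
  exists 0, 1; rewrite oner_eq0 orbT b0 lb; split=> //; ring.
exists (alpha * b), (lam - alpha * a); rewrite mulf_neq0 //; split=> //; first by ring.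
apply/eqP; rewrite -subr_eq0; apply/eqP.
transitivity (alpha * beta * (a ^+ 2 + b ^+ 2) + lam * (a * (alpha - beta) - lam)).
  by ring.
by rewrite hb hl; ring.
Qed.

(** The vector with entries [- q^*] and [p^*] is orthogonal to the one with entries [p] and [q]; its
    equations are the conjugated ones, as [z^* = z^-1] on the unit circle. *)
Lemma reflection_orthogonal_eigenvector (C : numClosedFieldType)
    (alpha beta lam a b p q : C) :
  `|alpha| = 1 -> `|beta| = 1 -> `|lam| = 1 -> a^* = a -> b^* = b ->
  alpha * (a * p + b * q) = lam * p -> beta * (b * p - a * q) = lam * q ->
  let mu := - (alpha * beta / lam) in
  alpha * (a * - q^* + b * p^*) = mu * - q^* /\
  beta * (b * - q^* - a * p^*) = mu * p^*.
Proof.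
move=> a1 b1 l1 aR bR h1 h2 mu.
have a0 : alpha != 0 by rewrite -normr_eq0 a1 oner_eq0.
have b0 : beta != 0 by rewrite -normr_eq0 b1 oner_eq0.
have l0 : lam != 0 by rewrite -normr_eq0 l1 oner_eq0.
move/(congr1 (fun z => z^*)): h1; rewrite !(rmorphM, rmorphD) /= aR bR (unit_conj a1) (unit_conj l1) => h1.
move/(congr1 (fun z => z^*)): h2; rewrite !(rmorphM, rmorphB) /= aR bR (unit_conj b1) (unit_conj l1) => h2.
have e1 : a * p^* + b * q^* = alpha * (lam^-1 * p^*) by rewrite -h1 mulVKf.
have e2 : b * p^* - a * q^* = beta * (lam^-1 * q^*) by rewrite -h2 mulVKf.
split.
  transitivity (alpha * (b * p^* - a * q^*)); first by ring.
  by rewrite e2 /mu; ring.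
transitivity (- beta * (a * p^* + b * q^*)); first by ring.
by rewrite e1 /mu; ring.
Qed.

(** * Diagonal matrices, permutation matrices and conjugated involutions *)

Definition dgm (C : nzRingType) (n : nat) (f : 'I_n -> C) : 'M[C]_n :=
  diag_mx (\row_i f i).

Lemma eq_dgm (C : nzRingType) (n : nat) (f g : 'I_n -> C) :
  f =1 g -> dgm f = dgm g.
Proof. by move=> fg; congr diag_mx; apply/rowP => i; rewrite !mxE. Qed.

Lemma dgmM (C : nzRingType) (n : nat) (f g : 'I_n -> C) :
  dgm f *m dgm g = dgm (fun i => f i * g i).
Proof.
by rewrite /dgm mulmx_diag; congr diag_mx; apply/rowP => i; rewrite !mxE.
Qed.

Lemma dgmD (C : nzRingType) (n : nat) (f g : 'I_n -> C) :
  dgm f + dgm g = dgm (fun i => f i + g i).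
Proof.
by rewrite /dgm -raddfD; congr diag_mx; apply/rowP => i; rewrite !mxE.
Qed.

Lemma dgmN (C : nzRingType) (n : nat) (f : 'I_n -> C) :
  - dgm f = dgm (fun i => - f i).
Proof.
by rewrite /dgm -raddfN; congr diag_mx; apply/rowP => i; rewrite !mxE.
Qed.

Lemma dgmZ (C : nzRingType) (n : nat) (c : C) (f : 'I_n -> C) :
  c *: dgm f = dgm (fun i => c * f i).
Proof.
by rewrite /dgm -linearZ /=; congr diag_mx; apply/rowP => i; rewrite !mxE.
Qed.

Lemma dgm_const (C : nzRingType) (n : nat) (c : C) :
  dgm (fun _ : 'I_n => c) = c%:M.
Proof. by rewrite -diag_const_mx; congr diag_mx; apply/rowP => i; rewrite !mxE. Qed.

Lemma dgm0 (C : nzRingType) (n : nat) : dgm (fun _ : 'I_n => 0 : C) = 0.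
Proof. by rewrite dgm_const raddf0. Qed.

Lemma adj_dgm (C : numClosedFieldType) (n : nat) (f : 'I_n -> C) :
  ((dgm f) ^t* = dgm (fun i => (f i)^*))%sesqui.
Proof.
apply/matrixP => i j; rewrite !mxE eq_sym.
by case: eqP => [->|_]; rewrite ?mulr1n ?mulr0n ?rmorph0.
Qed.

Lemma dgm_perm (C : nzRingType) (n : nat) (f g : 'I_n -> C) (s : 'S_n) :
  (forall i, f i = g (s i)) -> dgm f *m perm_mx s = perm_mx s *m dgm g.
Proof.
move=> fg; rewrite /dgm mul_diag_mx mul_mx_diag.
apply/matrixP => i j; rewrite !mxE fg.
by case: eqP => [->|_]; rewrite ?mulr1 ?mul1r // mulr0 mul0r.
Qed.

Lemma perm_mx_adj (C : numClosedFieldType) (n : nat) (s : 'S_n) :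
  (perm_mx s *m (perm_mx s) ^t* = 1%:M :> 'M[C]_n)%sesqui.
Proof.
by rewrite tr_perm_mx map_perm_mx -perm_mxM mulgV perm_mx1.
Qed.

Lemma unitary_conj_involution (C : numClosedFieldType) (n : nat)
    (Q S : 'M[C]_n) :
  ((Q *m Q ^t* = 1%:M) -> (S ^t* = S) -> (S *m S = 1%:M) ->
  let J := Q *m S *m Q ^t* in (J ^t* = J /\ J *m J = 1%:M))%sesqui.
Proof.
move=> hQ hS hSS J; split; first by rewrite !adjmxM trmxCK hS mulmxA.
rewrite /J !mulmxA -[_ *m _ *m Q]mulmxA (mulmx1C hQ) mulmx1.
by rewrite -[Q *m S *m S]mulmxA hSS mulmx1.
Qed.

(* The eigenvalues of [V J] are [lam i] and [mu i], hence [lam i] and their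
   conjugates; exchanging the eigenvectors of [lam i] and [conj (lam i)] is the
   symmetry [J1]. *)
Lemma paired_spectrum_factorisation (C : numClosedFieldType) (n : nat)
    (alpha beta : C) (lam a b : 'I_n -> C) (s : 'S_n) :
  `|alpha| = 1 -> `|beta| = 1 -> alpha != beta ->
  (forall i, `|lam i| = 1) -> (forall i, (a i)^* = a i) ->
  (forall i, (b i)^* = b i) -> (forall i, a i ^+ 2 + b i ^+ 2 = 1) ->
  (forall i, lam i * (lam (s i))^* = - (alpha * beta)) ->
  (forall i, a i * (alpha - beta) = lam i + (lam (s i))^*) ->
  exists J1 J2 : 'M[C]_(n + n),
    [/\ (J1 ^t* = J1)%sesqui, J1 *m J1 = 1%:M, (J2 ^t* = J2)%sesqui,
        J2 *m J2 = 1%:M &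
        block_mx alpha%:M 0 0 beta%:M *m block_mx (dgm a) (dgm b) (dgm b) (- dgm a)
        = J1 *m J2].
Proof.
move=> a1 b1 ab l1 aR bR hab hl ha.
have a0 : alpha != 0 by rewrite -normr_eq0 a1 oner_eq0.
have b0 : beta != 0 by rewrite -normr_eq0 b1 oner_eq0.
have l0 i : lam i != 0 by rewrite -normr_eq0 l1 oner_eq0.
have [p hp] := fin_all_exists (fun i => reflection_unit_eigenvector a0 (ha i) (hl i) (hab i)).
have [q hpq] := fin_all_exists hp.
pose P : 'M[C]_n := perm_mx s.
have PP : (P *m P ^t* = 1%:M)%sesqui by exact: perm_mx_adj.
pose mu i := (lam (s i))^*.
have muE i : mu i = - (alpha * beta / lam i).
  by apply: (mulfI (l0 i)); rewrite hl mulrN [lam i * _]mulrC divfK.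
have hmu i : alpha * (a i * - (q i)^* + b i * (p i)^*) = mu i * - (q i)^* /\
     beta * (b i * - (q i)^* - a i * (p i)^*) = mu i * (p i)^*.
  have [_ h1 h2] := hpq i; rewrite muE.
  exact: (reflection_orthogonal_eigenvector a1 b1 (l1 i) (aR i) (bR i) h1 h2).
pose nq i := - (q i)^*; pose cp i := (p i)^*.
(* The columns of [Q] are orthonormal eigenvectors of [W]. The factor [P] reorders those for [mu i],
   so that the right half lists the conjugates of [lam i] in order. *)
pose Q := block_mx (dgm p) (dgm nq *m P) (dgm q) (dgm cp *m P).
pose lc i := (lam i)^*.
pose Delta := block_mx (dgm lam) 0 0 (dgm lc).
pose W := block_mx (alpha%:M : 'M_n) 0 0 (beta%:M : 'M_n)
  *m block_mx (dgm a) (dgm b) (dgm b) (- dgm a).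
have WQ : W *m Q = Q *m Delta.
  rewrite /W /Q /Delta !mulmx_block !mul0mx !mulmx0 !addr0 !add0r.
  rewrite !mul_scalar_mx -!mulmxA -(@dgm_perm _ _ mu lc s) // !mulmxA.
  rewrite -!mulmxDl !dgmN !dgmZ !dgmM !dgmD.
  congr block_mx; try congr mulmx; apply: eq_dgm => i /=;
    have [_ h1 h2] := hpq i; have [h3 h4] := hmu i;
    rewrite [RHS]mulrC /nq /cp -?h1 -?h2 -?h3 -?h4; ring.
have QQ : (Q *m Q ^t* = 1%:M)%sesqui.
  rewrite /Q tr_block_mx map_block_mx !adjmxM !adj_dgm mulmx_block.
  rewrite !mulmxA -!(mulmxA _ P) PP !mulmx1 !dgmM !dgmD.
  rewrite [RHS]scalar_mx_block -dgm_const -dgm0.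
  have hp1 k : p k * (p k)^* + q k * (q k)^* = 1 by case: (hpq k).
  congr block_mx; apply: eq_dgm => i; rewrite /nq /cp ?rmorphN /= ?conjCK -?(hp1 i);
    ring.
(* With [S] the exchange of the two halves and [S' = S Delta], also an involution, [W = Q Delta Q^*]
   is the product of the conjugates of [S] and [S'] by [Q]. *)
pose S : 'M[C]_(n + n) := block_mx 0 1%:M 1%:M 0.
pose S' : 'M[C]_(n + n) := block_mx 0 (dgm lc) (dgm lam) 0.
have SE : S *m Delta = S'.
  by rewrite /S /Delta mulmx_block !mul0mx !mulmx0 !mul1mx !addr0 !add0r.
have S'adj : (S' ^t* = S')%sesqui.
  rewrite /S' tr_block_mx map_block_mx !adj_dgm !trmx0 !map_mx0.
  by congr block_mx; apply: eq_dgm => i; rewrite /lc ?conjCK.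
have S'S' : S' *m S' = 1%:M.
  rewrite /S' mulmx_block !mul0mx !mulmx0 !addr0 !add0r !dgmM.
  rewrite [RHS]scalar_mx_block -dgm_const.
  by congr block_mx; apply: eq_dgm => i; rewrite /lc -?normCK -?normCKC l1 expr1n.
have Sadj : (S ^t* = S)%sesqui.
  by rewrite /S tr_block_mx map_block_mx !trmx1 !map_mx1 !trmx0 !map_mx0.
have SS : S *m S = 1%:M.
  rewrite /S mulmx_block !mul0mx !mulmx0 !addr0 !add0r mul1mx.
  by rewrite [RHS]scalar_mx_block.
have [h1 h2] := unitary_conj_involution QQ Sadj SS.
have [h3 h4] := unitary_conj_involution QQ S'adj S'S'.
exists (Q *m S *m (Q ^t*)%sesqui), (Q *m S' *m (Q ^t*)%sesqui); split=> //.
rewrite -/W !mulmxA -[_ *m _ *m Q]mulmxA (mulmx1C QQ) mulmx1 -SE.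
by rewrite !mulmxA -[Q *m S *m S]mulmxA SS mulmx1 -WQ -mulmxA QQ mulmx1.
Qed.

(** * The equivalence *)

Lemma is_symmetryP (R : realType) (d : nat) (J : 'M[R[i]]_d) :
  is_symmetry J <-> (J ^t* = J)%sesqui /\ J *m J = 1%:M.
Proof.
split=> [[h u hi]|[h hJ]]; first by split=> //; rewrite {2}hi mulmxV.
have [u _] := mulmx1_unit hJ; split=> //.
by rewrite -[LHS]mulmx1 -(mulmxV u) mulmxA hJ mul1mx.
Qed.

Lemma is_symmetry_blocks (R : realType) (m n : nat) (J : 'M[R[i]]_(m + n)) :
  is_symmetry J <-> exists A B D,
    J = block_mx A B (B ^t*)%sesqui D /\ symmetry_blocks A B D.
Proof.
rewrite is_symmetryP; split=> [[]|[A [B [D [-> hJ]]]]].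
  rewrite -[J]submxK; move: (ulsubmx J) (ursubmx J) (dlsubmx J) (drsubmx J).
  move=> A B C D; rewrite tr_block_mx map_block_mx => /eq_block_mx[hA _ hC hD].
  rewrite -hC mulmx_block [1%:M]scalar_mx_block => /eq_block_mx[h1 h2 _ h3].
  by exists A, B, D; split.
have [_ _ _ /= h4 _] := symmetry_blocks_swap hJ.
case: hJ => hA hD h1 h2 h3; split.
  by rewrite tr_block_mx map_block_mx hA hD trmxCK.
by rewrite mulmx_block h1 h2 h3 addrC h4 -scalar_mx_block.
Qed.

Lemma in_Sym3_mul (R : realType) (d : nat) (J1 J2 J3 : 'M[R[i]]_d) :
  is_symmetry J1 -> is_symmetry J2 -> is_symmetry J3 ->
  in_Sym 3 (J1 *m J2 *m J3).
Proof.
move=> h1 h2 h3; exists (fun i : 'I_3 => nth 0 [:: J1; J2; J3] i); split.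
  by case=> -[|[|[|]]].
by rewrite !big_ord_recl big_ord0 /= mulmx1 mulmxA.
Qed.

(** Two signs add up to [2], [0] or [- 2], never to [1]. *)
Lemma balanced_signs (C : numClosedFieldType) (a b : C) :
  a ^+ 2 = 1 -> b ^+ 2 = 1 -> a + b = 0 \/ a + b = 1 -> b = - a.
Proof.
move=> /eqP; rewrite sqrf_eq1 => ha /eqP; rewrite sqrf_eq1 => hb h.
case: h => [/eqP|]; first by rewrite addrC addr_eq0 => /eqP.
have n1 : (2 : C) <> 1 by apply/eqP; rewrite -subr_eq0 -addrA subrr addr0 oner_eq0.
have n3 : (3 : C) != 0 by rewrite pnatr_eq0.
case/orP: ha => /eqP ->; case/orP: hb => /eqP -> // h; rewrite ?opprK //.
case/eqP: n3; have -> : (3 : C) = 1 - (-1 - 1) by ring.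
by rewrite h subrr.
Qed.

(** Conjugation divides both the numerator and the denominator by [- alpha beta]. *)
Lemma corner_eigenvalue_real (C : numClosedFieldType) (alpha beta lam : C) :
  `|alpha| = 1 -> `|beta| = 1 -> `|lam| = 1 -> alpha != beta ->
  (corner_eigenvalue alpha beta lam)^* = corner_eigenvalue alpha beta lam.
Proof.
move=> a1 b1 l1 ab; have d0 : alpha - beta != 0 by rewrite subr_eq0.
have d0' : beta - alpha != 0 by rewrite subr_eq0 eq_sym.
have a0 : alpha != 0 by rewrite -normr_eq0 a1 oner_eq0.
have b0 : beta != 0 by rewrite -normr_eq0 b1 oner_eq0.
have l0 : lam != 0 by rewrite -normr_eq0 l1 oner_eq0.
rewrite /corner_eigenvalue !(rmorphM, rmorphB, fmorphV) /= !unit_conj //.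
by field; rewrite a0 b0 l0 d0 mulN1r d0'.
Qed.

Lemma sqrt_one_sub_sq_real (C : numClosedFieldType) (a : C) :
  a^* = a -> `|a| <= 1 -> (sqrtC (1 - a ^+ 2))^* = sqrtC (1 - a ^+ 2).
Proof.
move=> aR a1; apply: geC0_conj; rewrite sqrtC_ge0 expr2 -{2}aR -normCK subr_ge0.
by rewrite exprn_ile1 ?normr_ge0.
Qed.

Lemma dgm_symmetry_blocks (C : numClosedFieldType) (n : nat) (a b : 'I_n -> C) :
  (forall i, (a i)^* = a i) -> (forall i, (b i)^* = b i) ->
  (forall i, a i ^+ 2 + b i ^+ 2 = 1) ->
  symmetry_blocks (dgm a) (dgm b) (- dgm a).
Proof.
move=> aR bR ab; have aT : ((dgm a) ^t* = dgm a)%sesqui.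
  by rewrite adj_dgm; apply: eq_dgm.
have bT : ((dgm b) ^t* = dgm b)%sesqui by rewrite adj_dgm; apply: eq_dgm.
split=> //; rewrite ?bT.
- by rewrite dgmN adj_dgm; apply: eq_dgm => i; rewrite rmorphN /= aR.
- by rewrite !dgmM dgmD -dgm_const; apply: eq_dgm => i; rewrite -(ab i); ring.
- by rewrite mulmxN !dgmM dgmN dgmD -dgm0;
    apply: eq_dgm => i; ring.
- rewrite mulNmx mulmxN opprK !dgmM dgmD -dgm_const.
  by apply: eq_dgm => i; rewrite -(ab i); ring.
Qed.

Lemma dgm_kernel_line (F : fieldType) (n : nat) (b : 'I_n -> F) (i0 : 'I_n) :
  b i0 = 0 -> (forall i, i != i0 -> b i != 0) ->
  exists2 e : 'cV_n, e != 0 /\ dgm b *m e = 0 &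
     forall x : 'cV_n, dgm b *m x = 0 -> exists c, x = c *: e.
Proof.
move=> b0 bn; exists (delta_mx i0 0).
  split.
    apply/eqP => /colP /(_ i0) /eqP.
    by rewrite !mxE !eqxx oner_eq0.
  apply/colP => i; rewrite mul_diag_mx !mxE.
  by case: eqP => [->|_]; rewrite ?b0 ?mul0r // mulr0.
move=> x /colP h; exists (x i0 0); apply/colP => i; rewrite !mxE eqxx andbT.
have [->|ii] := eqVneq i i0; first by rewrite mulr1.
move/eqP: (h i); rewrite mul_diag_mx !mxE mulf_eq0 (negPf (bn _ ii)) /= => /eqP->.
by rewrite mulr0.
Qed.

Theorem theorem3p16 (R : realType) (r s : nat) (alpha beta : R[i]) :
  let d := (r + s)%N in
  let V : 'M[R[i]]_d := block_mx (alpha%:M : 'M_r) 0 0 (beta%:M : 'M_s) in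
  let H1 := mxker (V - alpha%:M) in
  let H2 := mxker (V - beta%:M) in
  (4 <= d)%N -> ~~ odd d -> (1 <= s <= r)%N ->
  `|alpha| = 1 -> `|beta| = 1 -> alpha <> beta ->
  condition_P r s alpha beta ->
  (in_Sym 3 V /\
   exists J1 J2 J : 'M[R[i]]_d,
     [/\ is_symmetry J1, is_symmetry J2 & is_symmetry J] /\
     [/\ V = J1 *m J2 *m J, balanced J & \dim (stdM H1 H2 J) = 1%N])
  <->
  [/\ ~~ (4 %| d)%N,
      s = (d %/ 2)%N /\ r = (d %/ 2)%N,
      alpha ^+ (d %/ 2) * beta ^+ (d %/ 2) = - 1 &
      let d0 := (d %/ 2 - 1)%N in
      forall j : nat, (1 <= j <= d0)%N ->
        `|1 - alpha ^+ (2 * j + 1) * beta ^+ (2 * j - 1)| < `|alpha - beta|].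
Proof.
cbv zeta; move=> d4 dev sr a1 b1 /eqP ab hP; split.
  case=> _ [J1 [J2 [J [[hJ1 hJ2 hJ] [hV hbal hdim]]]]].
  have [_ JJ] := (is_symmetryP _).1 hJ.
  have [_ J11] := (is_symmetryP _).1 hJ1.
  have [_ J22] := (is_symmetryP _).1 hJ2.
  have [A [B [D [JE hS]]]] := (is_symmetry_blocks _).1 hJ.
  rewrite JE in hdim; have [e [e0 Be] kerE] := (dim_stdM_eq1 ab hS).1 hdim.
  have rk : (\rank B).+1 = r.
    rewrite -[RHS](kernel_line_rank (B ^t*)%sesqui).1 ?mxrank_map ?mxrank_tr //.
    by exists e.
  (* The rank [r - 1] of [B] is at most [s], and [s <= r]; the parity of [r + s] leaves only
     [s = r]. *)
  have rs : s = r by have := rank_leq_col B; lia.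
  have hW : block_mx alpha%:M 0 0 beta%:M *m J = J1 *m J2.
    by rewrite hV -!mulmxA JJ mulmx1.
  rewrite JE in hW.
  rewrite JE in hbal; clear JE hJ JJ hV hdim.
  subst s.
  (* [B] is now square, so its own kernel is a line too, which gives [dim M_2 = 1]. *)
  have [f [f0 Bf] kerF] := (kernel_line_rank B).2 rk.
  have [eps eps1 he] := corner_kernel_line hS e0 Be kerE.
  have [||eps' eps'1 hf] := corner_kernel_line (symmetry_blocks_swap hS) f0.
    by rewrite trmxCK.
    by rewrite trmxCK.
  have eps'R : eps'^* = eps'.
    by move/eqP: eps'1; rewrite sqrf_eq1 => /orP[]/eqP->; rewrite ?rmorphN rmorph1.
  have tr := corner_trace hS e0 f0 Be Bf kerF he hf eps'R.
  have eE : eps' = - eps.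
    by apply: balanced_signs => //; rewrite -tr -(mxtrace_block A B (B ^t*)%sesqui).
  rewrite eE in hf.
  have r0 : (0 < r)%N by lia.
  have sg := chain_sign hS J11 J22 hW hP a1 b1 ab r0 e0 eps1 he hf kerE kerF.
  have ro := condition_P_sign_odd r0 hP sg.
  have -> : ((r + r) %/ 2 = r)%N by lia.
  split=> //; first by lia.
    by rewrite sg -signr_odd ro expr1.
  move=> j jr.
  (* The inequality for [j] comes from index [j - 1] of the chain. *)
  have -> : (2 * j + 1 = 2 * j.-1 + 3)%N by lia.
  have -> : (2 * j - 1 = 2 * j.-1 + 1)%N by lia.
  by apply: (chain_strict hS J11 J22 hW hP a1 b1 ab e0 eps1 he); lia.
case=> d4n [hs hr]; have rs : s = r by rewrite hs -hr.
rewrite -hr; clear hs hr; subst s => sg strict.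
have ro : odd r by lia.
(* The chain with [eps = 1] gives half of the spectrum of [W]. Consecutive values have ratio
   [- alpha beta], so pairing uses the cyclic predecessor [s]. *)
pose lam (i : 'I_r) := chain_eigenvalue alpha beta 1 i.
pose s : 'S_r := perm (@ord_pred_inj r).
have a0 : alpha != 0 by rewrite -normr_eq0 a1 oner_eq0.
have b0 : beta != 0 by rewrite -normr_eq0 b1 oner_eq0.
have l1 i : `|lam i| = 1.
  by rewrite /lam /chain_eigenvalue !normrM !normrX a1 b1 normrN1 normr1 !expr1n !mulr1.
have l0 i : lam i != 0 by rewrite -normr_eq0 l1 oner_eq0.
have hl i : lam i * (lam (s i))^* = - (alpha * beta).
  rewrite unit_conj //; apply: (mulIf (l0 (s i))); rewrite mulfVK //.
  rewrite permE /lam; case: i => -[|k] ir; rewrite /chain_eigenvalue /=.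
    (* The cycle closes at index 0, whose predecessor is [r - 1]: this uses that [r] is odd and
       [alpha^r beta^r = - 1]. *)
    rewrite add0n modn_small ?prednK //.
    have -> : (-1) ^+ r.-1 = 1 :> R[i].
      have re : ~~ odd r.-1 by rewrite -oddS prednK.
      by rewrite -signr_odd (negPf re).
    transitivity (- alpha * (alpha ^+ r * beta ^+ r)); first by rewrite sg; ring.
    by rewrite -{2}(prednK ir) [beta ^+ _.+1]exprS; ring.
  by rewrite modnDr modn_small; [rewrite !exprS; ring | lia].
pose a i := corner_eigenvalue alpha beta (lam i).
pose b i := sqrtC (1 - a i ^+ 2).
have d0 : alpha - beta != 0 by rewrite subr_eq0.
have ha i : a i * (alpha - beta) = lam i + (lam (s i))^*.
  rewrite /a /corner_eigenvalue divfK //; congr (_ + _).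
  by apply: (mulfI (l0 i)); rewrite hl mulrN mulrC divfK.
have aR i : (a i)^* = a i by exact: corner_eigenvalue_real.
have r0 : (0 < r)%N by lia.
pose i0 := Ordinal r0.
(* Here [lam i0 = alpha]; this index makes [b] vanish and yields the line [M_1]. *)
have ai0 : a i0 = 1.
  rewrite /a /lam /chain_eigenvalue /= !expr0 expr1 !mul1r mulr1 /corner_eigenvalue.
  by field; rewrite a0 d0.
have an i : i != i0 -> `|a i| < 1.
  case: i => -[|k] ir ii; first by case/eqP: ii; apply: val_inj.
  have dp : 0 < `|alpha - beta| by rewrite normr_gt0.
  rewrite /a /corner_eigenvalue normf_div ltr_pdivrMr // mul1r.
  (* The hypothesis for [j = k + 1] bounds the corner eigenvalue of index [k + 1], since
     [l^2 - alpha beta] is its left-hand difference times [- alpha beta]. *)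
  have := strict k.+1; rewrite (_ : (2 * k.+1 - 1 = k.+1 + k)%N); last by lia.
  rewrite (_ : (2 * k.+1 + 1 = k.+2 + k.+1)%N); last by lia.
  set l := lam _ => st; have -> : `|l - alpha * beta / l| =
      `|1 - alpha ^+ (k.+2 + k.+1) * beta ^+ (k.+1 + k)|.
    rewrite -[LHS]mul1r -{1}(l1 (Ordinal ir)) -/l -normrM.
    have -> : l * (l - alpha * beta / l) = l ^+ 2 - alpha * beta.
      by field; exact: l0.
    rewrite chain_eigenvalue_sq ?expr1n //=.
    have -> : (alpha ^+ k.+2 * beta ^+ k.+1) ^+ 2 - alpha * beta = - (alpha * beta)
        * (1 - alpha ^+ (k.+2 + k.+1) * beta ^+ (k.+1 + k)).
      by rewrite !exprD !exprS; ring.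
    by rewrite !normrM normrN normrM a1 b1 !mul1r.
  by apply: st; lia.
have ab1 i : `|a i| <= 1.
  by have [->|/an/ltW//] := eqVneq i i0; rewrite ai0 normr1.
have bR i : (b i)^* = b i by exact: sqrt_one_sub_sq_real.
have b2 i : a i ^+ 2 + b i ^+ 2 = 1 by rewrite sqrtCK addrC subrK.
have bi0 : b i0 = 0 by rewrite /b ai0 expr1n subrr sqrtC0.
have bn i : i != i0 -> b i != 0.
  move/an => ai; rewrite -sqrf_eq0 sqrtCK subr_eq0; apply: contraTneq ai => h.
  by rewrite -(@ltr_pXn2r _ 2) ?nnegrE // -normrX -h normr1 expr1n ltxx.
have [J1 [J2 [J1s J11 J2s J22 hW]]] :=
  paired_spectrum_factorisation a1 b1 ab l1 aR bR b2 hl ha.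
have hS := dgm_symmetry_blocks aR bR b2.
have bT : ((dgm b) ^t* = dgm b)%sesqui by rewrite adj_dgm; apply: eq_dgm.
pose J := block_mx (dgm a) (dgm b) ((dgm b) ^t*)%sesqui (- dgm a).
have hJ1 : is_symmetry J1 by apply/is_symmetryP.
have hJ2 : is_symmetry J2 by apply/is_symmetryP.
have hJ : is_symmetry J by apply/is_symmetry_blocks; exists (dgm a), (dgm b), (- dgm a).
have VE : block_mx alpha%:M 0 0 beta%:M = J1 *m J2 *m J.
  have [_ JJ] := (is_symmetryP _).1 hJ.
  have JE : J = block_mx (dgm a) (dgm b) (dgm b) (- dgm a) by rewrite /J bT.
  by rewrite -hW -JE -mulmxA JJ mulmx1.
split; first by rewrite VE; exact: in_Sym3_mul.
exists J1, J2, J; do 2!split=> //.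
  by left; rewrite mxtrace_block raddfN /= subrr.
by apply/(dim_stdM_eq1 ab hS); rewrite bT; exact: dgm_kernel_line bi0 bn.
Qed.
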